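(* Let $M$ be a smooth manifold, $\tau\in\Omega^1(M)$, $\omega\in\Omega^2(M)$, and $r\ge 0$ an integer. The following statements are equivalent: (i) $\tau$ is nowhere-vanishing and $(\tau,\omega)$ has constant class, either $2r+1$ or $2r+2$. (ii) $\omega$ has constant rank, and at every point $\tau\wedge\omega^r\neq 0$ and $\tau\wedge\omega^{r+1}=0$. Provided these equivalent conditions hold, if $\omega^{r+1}=0$ then the class is odd, and if $\omega^{r+1}\neq 0$ then the class is even.
   Context: The class of a pair $(\tau,\omega)$ at $x\in M$ is the codimension in $T_xM$ of $\operatorname{Ker}\tau_x\cap\operatorname{Ker}\omega_x$, where $\operatorname{Ker}\alpha_x=\{v\in T_xM\mid\iota_v\alpha_x=0\}$. The rank of $\omega$ at $x$ is the codimension of $\operatorname{Ker}\omega_x$. $\omega^r$ denotes the exterior product of $r$ copies of $\omega$ (with $\omega^0=1$). *)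

(* Defs.v *)
From HB Require Import structures.
From mathcomp Require Export all_boot all_order all_algebra all_fingroup.
From mathcomp Require Export all_classical all_reals all_analysis.
Export Order.TTheory GRing.Theory Num.Theory.
Export numFieldNormedType.Exports.

Set Implicit Arguments.
Unset Strict Implicit.
Unset Printing Implicit Defensive.

Local Open Scope ring_scope.
Local Open Scope classical_set_scope.

Section Smoothness.
Context {R : realType} {V W : normedModType R}.

(* Intended for [U] open and [V] finite-dimensional, where existence and
   continuity of all iterated directional derivatives up to order [k] is the
   usual notion of class C^k. *)
Fixpoint Ck_on (k : nat) (U : set V) (f : V -> W) : Prop :=
  (forall y, U y -> {for y, continuous f}) /\
  if k is k'.+1 then
    forall v, (forall y, U y -> derivable f y v) /\ Ck_on k' U ('D_v f)
  else True.

Definition smooth_on (U : set V) (f : V -> W) : Prop := forall k, Ck_on k U f.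

End Smoothness.

(* A homeomorphism from the open set [chart_dom] onto the open set [chart_cod];
   [chart_map] and [chart_inv] have irrelevant values elsewhere. *)
Record chart (R : realType) (n : nat) (M : topologicalType) := Chart {
  chart_dom : set M;
  chart_cod : set 'rV[R]_n;
  chart_map : M -> 'rV[R]_n;
  chart_inv : 'rV[R]_n -> M;
  chart_dom_open : open chart_dom;
  chart_cod_open : open chart_cod;
  chart_map_cod : forall x, chart_dom x -> chart_cod (chart_map x);
  chart_inv_dom : forall y, chart_cod y -> chart_dom (chart_inv y);
  chart_mapK : forall x, chart_dom x -> chart_inv (chart_map x) = x;
  chart_invK : forall y, chart_cod y -> chart_map (chart_inv y) = y;
  chart_map_continuous : {within chart_dom, continuous chart_map};
  chart_inv_continuous : {within chart_cod, continuous chart_inv}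
}.

(* Besides the atlas, every point comes with a preferred chart around it; it
   is only used to coordinatize the tangent space at that point. *)
Record smooth_manifold (R : realType) (n : nat) := SmoothManifold {
  carrier :> topologicalType;
  carrier_hausdorff : hausdorff_space carrier;
  carrier_second_countable : @second_countable carrier;
  atlas_index : Type;
  atlas : atlas_index -> chart R n carrier;
  chart_at : carrier -> atlas_index;
  chart_at_dom : forall x, chart_dom (atlas (chart_at x)) x;
  atlas_smooth : forall i j,
    smooth_on (chart_cod (atlas i) `&`
               chart_inv (atlas i) @^-1` chart_dom (atlas j))
      (chart_map (atlas j) \o chart_inv (atlas i))
}.

(* T_xM: a tangent vector is given by its components in the preferred chart
   at x. *)
Definition tangent (R : realType) (n : nat) (M : smooth_manifold R n) (x : M) :
  vectType R := 'rV[R]_n.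

Section ExteriorAlgebra.
Context {R : realType} {n : nat}.

(* The k-tuple of vectors (v_1, ..., v_k) of R^n is encoded as the matrix whose
   rows are the v_i. *)
Definition kform (k : nat) : Type := 'M[R]_(k, n) -> R.

Definition multilinear k (a : kform k) : Prop :=
  forall (i : 'I_k) (A B C : 'M[R]_(k, n)) (b c : R),
    row i A = b *: row i B + c *: row i C ->
    row' i B = row' i A -> row' i C = row' i A ->
    a A = b * a B + c * a C.

Definition alternating k (a : kform k) : Prop :=
  forall (A : 'M[R]_(k, n)) (i j : 'I_k), i != j -> row i A = row j A -> a A = 0.

Definition contract k (v : 'rV[R]_n) (a : kform k.+1) : kform k :=
  fun A => a (col_mx v A).

(* (a /\ b)(v_1, ..., v_{p+q}) = 1/(p! q!) *
     sum_s sgn(s) a(v_{s 1}, ..., v_{s p}) b(v_{s (p+1)}, ..., v_{s (p+q)}) *)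
Definition wedge p q (a : kform p) (b : kform q) : kform (p + q) :=
  fun A => (p`!%:R * q`!%:R)^-1 *
    \sum_(s : 'S_(p + q)) (-1) ^+ s *
      (a (usubmx (row_perm s A)) * b (dsubmx (row_perm s A))).

Fixpoint wedge_exp (w : kform 2) (r : nat) : kform (r * 2) :=
  if r is r'.+1 then wedge w (@wedge_exp w r') else fun=> 1.

Definition kform_ker k (a : kform k.+1) : set 'rV[R]_n :=
  [set v | contract v a = fun=> 0].

End ExteriorAlgebra.
Arguments kform : clear implicits.
Arguments wedge_exp {R n} w r _.

(* The matrix ['J ... y] is the differential at [y] of the transition from the
   chart [i] to the preferred chart at [chart_inv (atlas i) y], so that the
   function in [dform_smooth] is the local expression in the chart [i] of the
   form, evaluated on the constant vector fields given by the rows of [A]. *)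
Record diff_form (R : realType) (n : nat) (M : smooth_manifold R n) (k : nat) :=
DiffForm {
  dform_at :> M -> kform R n k;
  dform_multilinear : forall x, multilinear (dform_at x);
  dform_alternating : forall x, alternating (dform_at x);
  dform_smooth : forall (i : atlas_index M) (A : 'M[R]_(k, n)),
    smooth_on (chart_cod (atlas i))
      (fun y => let x := chart_inv (atlas i) y in
         dform_at x
           (A *m 'J (chart_map (atlas (chart_at x)) \o chart_inv (atlas i)) y))
}.

(* The default value 0 is only used if [K] is not a linear subspace, see
   [mem_vspace_of]. *)
Definition vspace_of (R : realType) (V : vectType R) (K : set V) : {vspace V} :=
  xget 0%VS [set U : {vspace V} | forall v, (v \in U) <-> K v].

Definition codim (R : realType) (V : vectType R) (K : set V) : nat :=
  (\dim {:V} - \dim (vspace_of K))%N.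

Lemma mem_vspace_of (R : realType) (V : vectType R) (K : set V) :
  K 0 -> (forall a u v, K u -> K v -> K (a *: u + v)) ->
  forall v, (v \in vspace_of K) <-> K v.
Proof.
move=> K0 KD.
suff [U KU] : exists U : {vspace V}, forall v, (v \in U) <-> K v.
  rewrite /vspace_of; case: xgetP => [_ -> //|/(_ U)] /=.
  by move=> /(_ KU).
suff H d (U : {vspace V}) : (\dim {:V} - \dim U <= d)%N ->
    (forall v, v \in U -> K v) ->
    exists U : {vspace V}, forall v, (v \in U) <-> K v.
  by apply: (H _ 0%VS (leqnn _)) => v; rewrite memv0 => /eqP ->.
elim: d U => [|d IH] U leUd UK.
- exists U => v; split=> [/UK //|_].
  have /eqP -> : U == fullv by rewrite eqEdim subvf -subn_eq0 -leqn0.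
  exact: memvf.
- have [KU|/existsNP[v /not_implyP[Kv /negP vU]]] :=
    pselect (forall v, K v -> v \in U).
    by exists U => v; split=> [/UK|/KU].
  apply: (IH (U + <[v]>)%VS).
    have dimlt : (\dim U < \dim (U + <[v]>)%VS)%N.
      rewrite ltn_neqAle dimvS ?addvSl // andbT.
      apply: contra vU => /eqP dimE.
      have /eqP -> : U == (U + <[v]>)%VS by rewrite eqEdim addvSl dimE /=.
      by rewrite memvE addvSr.
    have := dimvS (subvf (U + <[v]>)%VS).
    by move: leUd; rewrite !leq_subLR => h1 h2; rewrite (leq_trans h1) // addnS -addSn leq_add2r.
  move=> w /memv_addP[u uU [_ /vlineP[a ->] ->]].
  by rewrite addrC; apply: KD => //; apply: UK.
Qed.

Lemma kform_ker_subspace (R : realType) (n k : nat) (a : kform R n k.+1) :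
  multilinear a ->
  kform_ker a 0 /\
  forall b u v, kform_ker a u -> kform_ker a v -> kform_ker a (b *: u + v).
Proof.
move=> ma.
have lin b (u v : 'rV[R]_n) (A : 'M[R]_(k, n)) :
    contract (b *: u + v) a A = b * contract u a A + contract v a A.
  rewrite -[contract v a A]mul1r.
  apply: (ma (@lshift 1 k ord0) (@col_mx R 1 k n (b *: u + v) A)
             (@col_mx R 1 k n u A) (@col_mx R 1 k n v A)).
  - rewrite scale1r; apply/rowP => j; rewrite !mxE.
    by rewrite !(unsplitK (inl _)) !mxE.
  - apply/matrixP => i j; rewrite !mxE; case: splitP => // z.
    by rewrite [z]ord1 /= /bump leq0n.
  - apply/matrixP => i j; rewrite !mxE; case: splitP => // z.
    by rewrite [z]ord1 /= /bump leq0n.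
split=> [|b u v /= ku kv].
  apply/funext => A.
  by have := lin (-1) 0 0 A; rewrite scaler0 addr0 mulN1r addNr.
apply/funext => A; rewrite lin.
by rewrite ku kv mulr0 addr0.
Qed.

Section Class.
Context {R : realType} {n : nat} {M : smooth_manifold R n}.

Definition form_rank k (alpha : diff_form M k.+1) (x : M) : nat :=
  @codim R (tangent x) (kform_ker (alpha x)).

Definition form_class (tau : diff_form M 1) (omega : diff_form M 2) (x : M) :
  nat := @codim R (tangent x) (kform_ker (tau x) `&` kform_ker (omega x)).

End Class.

(* Main.v *)
Require Import Defs.
From mathcomp Require Import ring lra zify.

(** Everything happens in one tangent space, where [tau] and [omega] are a
    linear form and an alternating bilinear form on R^n; at a
    point where the conditions on the products hold, the class and the rank
    determine each other, so that one is constant on the manifold when the other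
    is. Write [rk] for the rank of [omega] at the point and [c] for the class.

    - The power [omega^k] is nonzero exactly when [2k <= rk]
      ([wedge_exp_neq0P]). It vanishes for [2k > rk] because it is a form of
      degree [2k] whose kernel contains that of [omega], so any [2k] vectors
      are dependent modulo its kernel ([skew_eq0]). Conversely, suppose
      [omega^k] is nonzero on the vectors [A_1, ..., A_2k] and [2k < rk].
      Counting dimensions gives [u] outside the kernel of [omega] with
      [omega(u, A_i) = 0] for all [i]. Choosing [v] with [omega(u, v) <> 0],
      the value of [i_u omega^(k+1) = (k+1) (i_u omega) /\ omega^k] on
      [(v, A_1, ..., A_2k)] is [(k+1) omega(u, v) omega^k(A) <> 0]. Since both
      arguments apply to an odd rank and contradict each other there, the rank
      is even.

    - If [tau] does not vanish on the kernel of [omega], then [c = rk + 1].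
      Contracting [tau /\ omega^k] with a vector [v] of that kernel gives
      [tau(v) omega^k], so this product is nonzero exactly when [2k <= rk]
      ([wedge1_exp_transverse]).

    - If [tau] vanishes on the kernel of [omega], then [c = rk] and, by
      duality, [tau = i_v omega] for some [v]. Now
      [(k+1) tau /\ omega^k = i_v omega^(k+1)], so for [tau <> 0] the product
      is nonzero exactly when [2k + 2 <= rk] ([wedge1_exp_tangent]).

    [form_class_dichotomy] collects this. Nonvanishing of [tau /\ omega^r]
    and vanishing of [tau /\ omega^(r+1)] therefore mean [rk = 2r], [c = 2r+1]
    in the first case and [rk = c = 2r+2] in the second, and a constant rank
    decides which of the two holds at all points at once. The last assertion
    follows since [omega^(r+1)] vanishes for [rk = 2r] and not for
    [rk = 2r+2].

    The identities for the contraction [i_v] come from the Leibniz rules for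
    products with a form of degree 1 or 2, which in turn come from expanding a
    product over the row taken by the first argument of its first factor
    ([wedge_rec]), like a determinant along a column.
    Two forms of positive degree are equal as soon as their contractions are
    ([kformP]), so the commutation rules follow by induction on the degree. *)

Set Implicit Arguments.
Unset Strict Implicit.
Unset Printing Implicit Defensive.

Local Open Scope ring_scope.
Local Open Scope classical_set_scope.

(** * Expansion of the exterior product over the rows *)

Section Expansion.
Context {R : realType} {n : nat}.

(** Sorting permutations by the image of [ord0] turns the sum in [wedge] into an
    expansion along the rows. *)
Lemma sum_lift_perm m (F : 'S_m.+1 -> R) :
  \sum_s F s = \sum_i \sum_s F (lift_perm ord0 i s).
Proof.
pose h (p : 'I_m.+1 * 'S_m) := lift_perm ord0 p.1 p.2.
have h_inj : injective h.
  move=> [i s] [j t] /= E; have Eij : i = j.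
    by rewrite -(lift_perm_id ord0 i s) -(lift_perm_id ord0 j t) [lift_perm _ _ s]E.
  subst j; congr pair; apply/permP => k; apply: (@lift_inj _ i).
  by rewrite -(lift_perm_lift ord0) -[RHS](lift_perm_lift ord0) [lift_perm _ _ s]E.
have h_bij : bijective h.
  by apply: inj_card_bij h_inj _; rewrite card_prod card_ord !card_Sn factS.
by rewrite (reindex h) ?pair_bigA //=; apply: onW_bij.
Qed.

Lemma row_perm_lift m (i : 'I_m.+1) (s : 'S_m) (A : 'M[R]_(m.+1, n)) :
  row_perm (lift_perm ord0 i s) A =
    col_mx (row i A) (row_perm s (row' i A)) :> 'M[R]_(1 + m, n).
Proof.
apply/matrixP => k j; rewrite !mxE; case: splitP => [k' kE|k' kE].
  have -> : k = ord0 by apply: val_inj; rewrite /= kE [k']ord1.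
  by rewrite lift_perm_id mxE.
have -> : k = lift ord0 k' by apply: val_inj; rewrite /= kE.
by rewrite lift_perm_lift !mxE.
Qed.

Lemma row0_col_mx m (v : 'rV[R]_n) (A : 'M[R]_(m, n)) :
  row (ord0 : 'I_m.+1) (col_mx v A) = v.
Proof.
have -> : (ord0 : 'I_m.+1) = lshift m (ord0 : 'I_1) by apply: val_inj.
by rewrite -[RHS](row_id (ord0 : 'I_1)); apply: rowKu.
Qed.

Lemma rowS_col_mx m (v : 'rV[R]_n) (A : 'M[R]_(m, n)) i :
  row (lift (ord0 : 'I_m.+1) i) (col_mx v A) = row i A.
Proof.
have -> : lift (ord0 : 'I_m.+1) i = rshift 1 i by apply: val_inj.
exact: rowKd.
Qed.

Lemma row_row' m (A : 'M[R]_(m.+1, n)) i j :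
  row j (row' i A) = row (lift i j) A.
Proof. exact: row_rowsub. Qed.

Lemma row'0_col_mx m (v : 'rV[R]_n) (A : 'M[R]_(m, n)) :
  row' (ord0 : 'I_m.+1) (col_mx v A) = A.
Proof. by apply/row_matrixP => i; rewrite row_row' rowS_col_mx. Qed.

Lemma row'S_col_mx m (v : 'rV[R]_n) (A : 'M[R]_(m.+1, n)) i :
  row' (lift (ord0 : 'I_m.+2) i) (col_mx v A) =
    col_mx v (row' i A) :> 'M[R]_(1 + m, n).
Proof.
apply/row_matrixP => j; rewrite row_row'.
case: (unliftP ord0 j) => [k ->|->].
  rewrite rowS_col_mx row_row' -(rowS_col_mx v A); congr row.
  by apply: val_inj; rewrite /= /bump /=; lia.
rewrite row0_col_mx -[RHS](row0_col_mx v A); congr row.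
by apply: val_inj.
Qed.

Lemma col_mx_row0 m (A : 'M[R]_(m.+1, n)) :
  A = col_mx (row ord0 A) (row' ord0 A) :> 'M[R]_(1 + m, n).
Proof.
by rewrite -[in LHS](row_perm1 A) -(lift_perm1 ord0) row_perm_lift row_perm1.
Qed.

(** The induction step of the identities between forms below, which are proved by
    comparing contractions. *)
Lemma kformP k (a b : kform R n k.+1) :
  (forall v, contract v a = contract v b) -> a = b.
Proof.
move=> ab; apply/funext => A.
by rewrite [A]col_mx_row0; apply: (congr1 (@^~ _) (ab _)).
Qed.

(** The sign rule under permutation of the rows. Unlike multilinearity it holds
    for the product of any two functions by the very definition of [wedge], and
    it is all that the Leibniz rules require. *)
Definition skew k (a : kform R n k) :=
  forall (s : 'S_k) A, a (row_perm s A) = (-1) ^+ s * a A.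

Lemma skew_contract k (a : kform R n k.+1) v : skew a -> skew (contract v a).
Proof.
move=> sa s A; rewrite /contract.
have := sa (lift_perm ord0 ord0 s) (col_mx v A).
by rewrite row_perm_lift row0_col_mx row'0_col_mx odd_lift_perm addbb.
Qed.

Lemma skew_wedge p q (a : kform R n p) (b : kform R n q) : skew (wedge a b).
Proof.
move=> s A; rewrite /wedge mulrCA; congr (_ * _).
rewrite (reindex_inj (mulIg s^-1%g)) /= mulr_sumr.
apply: eq_bigr => t _.
by rewrite -row_permM mulgKV odd_permM odd_permV signr_addb [in RHS]mulrCA mulrA.
Qed.

(** Group the permutations defining the product by the index [i] of the row that
    they move to the first place: the other rows are permuted arbitrarily and
    moving row [i] there costs the sign [(-1)^i]. The factorials in the
    normalization of [wedge] leave [(p + 1)^-1]. *)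
Lemma wedge_rec p q (a : kform R n p.+1) (b : kform R n q)
    (A : 'M[R]_((p + q).+1, n)) :
  wedge a b A = p.+1%:R^-1 *
    \sum_(i < (p + q).+1) (-1) ^+ i * wedge (contract (row i A) a) b (row' i A).
Proof.
rewrite /wedge /= sum_lift_perm.
under [in RHS]eq_bigr => i _ do rewrite mulrCA.
rewrite -mulr_sumr mulrA; congr (_ * _).
  by rewrite factS natrM -mulrA invfM.
apply: eq_bigr => i _; rewrite mulr_sumr; apply: eq_bigr => s _.
rewrite odd_lift_perm /= signr_addb signr_odd -mulrA; congr (_ * (_ * _)).
rewrite row_perm_lift /contract.
set B := row_perm s _; set v := row i A.
have E : col_mx v B =
    col_mx (col_mx v (usubmx B)) (dsubmx B) :> 'M[R]_((1 + p) + q, n).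
  by rewrite -{1}[B]vsubmxK col_mxA castmx_id.
by rewrite E col_mxKu col_mxKd.
Qed.

(** The [q!] terms of the product are all equal by the sign rule. *)
Lemma wedge0E q (a : kform R n 0) (b : kform R n q) :
  skew b -> wedge a b = a 0 *: b.
Proof.
move=> sb; apply/funext => A; rewrite /wedge /=.
transitivity (q`!%:R^-1 * \sum_(s : 'S_q) (a 0 * b A)).
  rewrite mul1r; congr (_ * _); apply: eq_bigr => s _.
  rewrite (_ : usubmx _ = 0); last by apply/matrixP; case.
  rewrite (_ : dsubmx _ = row_perm s A); last first.
    by apply/matrixP => i j; rewrite !mxE; congr (A (s _) _); apply: val_inj.
  by rewrite sb mulrCA signrMK.
rewrite sumr_const card_Sn -[X in _ * X]mulr_natl mulKf //.
Qed.

End Expansion.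

(** * Leibniz rules for the contraction *)

Section Leibniz.
Context {R : realType} {n : nat}.

Lemma kformDE k (a b : kform R n k) A : (a + b) A = a A + b A.
Proof. by []. Qed.

Lemma kformNE k (a : kform R n k) A : (- a) A = - a A.
Proof. by []. Qed.

Lemma kformZE k c (a : kform R n k) A : (c *: a) A = c * a A.
Proof. by []. Qed.

Lemma wedgeZDl p q c (a a' : kform R n p) (b : kform R n q) :
  wedge (c *: a + a') b = c *: wedge a b + wedge a' b.
Proof.
apply/funext => A; rewrite kformDE kformZE /wedge mulrCA -mulrDr; congr (_ * _).
rewrite mulr_sumr -big_split; apply: eq_bigr => s _ /=.
rewrite kformDE kformZE.
by move: (a _) (a' _) (b _) (_ ^+ _) => x y z e; ring.
Qed.

Lemma wedgeZDr p q c (a : kform R n p) (b b' : kform R n q) :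
  wedge a (c *: b + b') = c *: wedge a b + wedge a b'.
Proof.
apply/funext => A; rewrite kformDE kformZE /wedge mulrCA -mulrDr; congr (_ * _).
rewrite mulr_sumr -big_split; apply: eq_bigr => s _ /=.
rewrite kformDE kformZE.
by move: (a _) (b _) (b' _) (_ ^+ _) => x y z e; ring.
Qed.

Lemma wedge0l p q (b : kform R n q) : wedge (0 : kform R n p) b = 0.
Proof.
have := wedgeZDl (-1) 0 (0 : kform R n p) b.
by rewrite scaler0 addr0 scaleN1r addNr.
Qed.

Lemma wedge0r p q (a : kform R n p) : wedge a (0 : kform R n q) = 0.
Proof.
have := wedgeZDr (-1) a 0 (0 : kform R n q).
by rewrite scaler0 addr0 scaleN1r addNr.
Qed.

Lemma wedgeDr p q (a : kform R n p) (b b' : kform R n q) :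
  wedge a (b + b') = wedge a b + wedge a b'.
Proof. by rewrite -[b in LHS]scale1r wedgeZDr scale1r. Qed.

Lemma wedgeZr p q c (a : kform R n p) (b : kform R n q) :
  wedge a (c *: b) = c *: wedge a b.
Proof. by rewrite -[_ *: b]addr0 wedgeZDr wedge0r addr0. Qed.

Lemma wedgeNr p q (a : kform R n p) (b : kform R n q) :
  wedge a (- b) = - wedge a b.
Proof. by rewrite -scaleN1r wedgeZr scaleN1r. Qed.

Lemma wedgeZBr p q c (a : kform R n p) (b b' : kform R n q) :
  wedge a (c *: b - b') = c *: wedge a b - wedge a b'.
Proof. by rewrite wedgeZDr wedgeNr. Qed.

(** The degree [1 + q] is written [q.+1] here, and likewise [q.+2] below, as
    contraction requires a successor. *)
Lemma skew_wedge1 q (t : kform R n 1) (b : kform R n q) :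
  @skew R n q.+1 (wedge t b).
Proof. exact: (@skew_wedge _ _ 1 q). Qed.

Lemma skew_wedge2 q (w : kform R n 2) (b : kform R n q) :
  @skew R n q.+2 (wedge w b).
Proof. exact: (@skew_wedge _ _ 2 q). Qed.

Lemma contract1E v (t : kform R n 1) : contract v t 0 = t v.
Proof.
rewrite /contract; congr t.
by rewrite -[LHS](row_id (ord0 : 'I_1)); apply: row0_col_mx.
Qed.

Lemma wedge1E q (t : kform R n 1) (b : kform R n q) (A : 'M[R]_(q.+1, n)) :
  skew b ->
  wedge t b A = \sum_(i < q.+1) (-1) ^+ i * (t (row i A) * b (row' i A)).
Proof.
move=> sb; rewrite (@wedge_rec _ _ 0) invr1 mul1r; apply: eq_bigr => i _.
by rewrite wedge0E // contract1E.
Qed.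

(** Degree 0 is apart because [b] then has no contraction. *)
Lemma contract_wedge1_deg0 v (t : kform R n 1) (b : kform R n 0) :
  skew b -> contract v (wedge t b) = t v *: b.
Proof.
move=> sb; apply/funext => A; rewrite /contract wedge1E // big_ord1 mul1r.
by rewrite row0_col_mx row'0_col_mx.
Qed.

(** The first term of the expansion of [wedge t b] along the rows [(v, A)] is
    the one where [t] takes [v]; in all others [v] stays in front of the rows left
    to [b]. *)
Lemma contract_wedge1 q v (t : kform R n 1) (b : kform R n q.+1) :
  skew b -> contract v (wedge t b) = t v *: b - wedge t (contract v b).
Proof.
move=> sb; apply/funext => A; rewrite {1}/contract wedge1E // big_ord_recl mul1r.
rewrite row0_col_mx row'0_col_mx !(kformDE, kformNE, kformZE); congr (_ + _).
rewrite wedge1E; last exact: skew_contract.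
rewrite -sumrN; apply: eq_bigr => i _.
by rewrite rowS_col_mx row'S_col_mx /= exprS mulN1r mulNr.
Qed.

Lemma skew2 (w : kform R n 2) u v :
  skew w -> contract u w v = - contract v w u.
Proof.
move=> sw; have := sw (lift_perm ord0 (lift ord0 ord0) 1%g) (col_mx v u).
rewrite row_perm_lift odd_lift_perm odd_perm1 row_perm1 rowS_col_mx row_id.
rewrite (row'S_col_mx v (u : 'M[R]_(1, n))) /= mulN1r /contract => <-.
congr (w (col_mx u _)).
by rewrite -[RHS](row_id (ord0 : 'I_1)); symmetry; apply: row0_col_mx.
Qed.

Lemma wedge2E q (w : kform R n 2) (b : kform R n q) (A : 'M[R]_(q.+2, n)) :
  wedge w b A = 2^-1 *
    \sum_(i < q.+2) (-1) ^+ i * wedge (contract (row i A) w) b (row' i A).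
Proof. exact: wedge_rec. Qed.

Lemma contract_wedge2_deg0 v (w : kform R n 2) (b : kform R n 0) :
  skew w -> skew b -> contract v (wedge w b) = wedge (contract v w) b.
Proof.
move=> sw sb; apply/funext => A; rewrite {1}/contract wedge2E big_ord_recl big_ord1.
rewrite row0_col_mx row'0_col_mx rowS_col_mx row'S_col_mx.
rewrite !wedge1E // !big_ord1 !row0_col_mx row'0_col_mx !mul1r /= expr1 (skew2 _ v) //.
by lra.
Qed.

(** Expand along the rows [(v, A)]. The first term is half of
    [(i_v w) /\ b]. In the term where [w] takes the row [A_i], the 1-form
    [i_(A_i) w] is multiplied by [b] and contracted with [v]: by the rule for
    1-forms and [w(A_i, v) = - w(v, A_i)], these terms add up to the other half
    of [(i_v w) /\ b] and to [w /\ i_v b]. *)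
Lemma contract_wedge2 q v (w : kform R n 2) (b : kform R n q.+1) :
  skew w -> skew b ->
  contract v (wedge w b) = wedge (contract v w) b + wedge w (contract v b).
Proof.
move=> sw sb; apply/funext => A.
rewrite {1}/contract wedge2E big_ord_recl mul1r row0_col_mx row'0_col_mx.
rewrite !(kformDE, kformNE, kformZE) wedge2E.
under eq_bigr => i _.
  rewrite rowS_col_mx row'S_col_mx.
  rewrite -[wedge _ b _]/(contract v (wedge (contract (row i A) w) b) (row' i A)).
  rewrite contract_wedge1 // !(kformDE, kformNE, kformZE) skew2 // /= exprS.
  rewrite (_ : _ * _ = (-1) ^+ i * (contract v w (row i A) * b (row' i A))
     + (-1) ^+ i * wedge (contract (row i A) w) (contract v b) (row' i A)); last first.
    by rewrite /GRing.scale /=; ring.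
  over.
rewrite big_split /= -wedge1E //.
by lra.
Qed.

Lemma wedge11_anticomm q (s t : kform R n 1) (b : kform R n q) :
  skew b -> wedge s (wedge t b) = - wedge t (wedge s b).
Proof.
elim: q b => [|q IH] b sb; apply: kformP => v.
  rewrite contract_wedge1; last exact: skew_wedge1.
  transitivity (- contract v (wedge t (wedge s b))) => //.
  rewrite contract_wedge1; last exact: skew_wedge1.
  by rewrite !contract_wedge1_deg0 // !wedgeZr opprB.
transitivity (- contract v (wedge t (wedge s b))) => //.
rewrite !contract_wedge1 //; try exact: skew_wedge1.
rewrite !wedgeZBr IH; last exact: skew_contract.
by rewrite !opprD !opprK addrCA addrA.
Qed.

(** These two identities are used at degrees such as [2 + q] and [1 + q.+1],
    which are equal only up to conversion. *)
Lemma kform_subNr k (a b : kform R n k) : a - - b = b + a.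
Proof. by rewrite opprK addrC. Qed.

Lemma kform_subND k (a b c : kform R n k) : a - (- b + c) = b + (a - c).
Proof. by rewrite opprD opprK addrCA. Qed.

(** Both sides have the same contractions, by induction on the degree of [b] and
    the anticommutation of 1-forms. *)
Lemma wedge12_comm q (t : kform R n 1) (w : kform R n 2) (b : kform R n q) :
  skew w -> skew b -> wedge t (wedge w b) = wedge w (wedge t b).
Proof.
move=> sw; elim: q b => [|q IH] b sb; apply: kformP => v.
  rewrite contract_wedge1; last exact: skew_wedge2.
  rewrite contract_wedge2 //; last exact: skew_wedge1.
  rewrite contract_wedge2_deg0 // contract_wedge1_deg0 //.
  rewrite (wedgeZr (t v)) (wedge11_anticomm t (contract v w)) //.
  exact: kform_subNr.
rewrite contract_wedge1; last exact: skew_wedge2.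
rewrite !contract_wedge2 //; last exact: skew_wedge1.
rewrite contract_wedge1 //.
rewrite wedgeZBr wedgeDr IH; last exact: skew_contract.
rewrite (wedge11_anticomm t (contract v w)) //.
exact: kform_subND.
Qed.

Lemma skew_wedge_exp (w : kform R n 2) k : skew (wedge_exp w k).
Proof.
case: k => [|k] /=; last exact: skew_wedge2.
move=> s A; rewrite (_ : s = 1%g) ?odd_perm1 ?mul1r //.
by apply/permP; case.
Qed.

(** Contraction is a derivation of even products: each of the [k + 1] factors
    contributes the same term, since 2-forms commute with 1-forms. *)
Lemma contract_wedge_exp (w : kform R n 2) k v : skew w ->
  contract v (wedge w (wedge_exp w k)) =
    k.+1%:R *: wedge (contract v w) (wedge_exp w k).
Proof.
move=> sw; elim: k => [|k IH] /=.
  by rewrite contract_wedge2_deg0 ?scale1r //; apply: (@skew_wedge_exp w 0).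
rewrite contract_wedge2 //; last exact: skew_wedge2.
rewrite IH (wedgeZr k.+1%:R) -wedge12_comm //; last exact: skew_wedge_exp.
by rewrite -[k.+2%:R]natr1 addrC scalerDl scale1r.
Qed.

End Leibniz.

(** * Linear forms, skew bilinear forms and their kernels *)

Section Rank.
Context {R : realType} {n : nat}.

(** For a transposition, expand [a] on the tuple whose rows [i] and [j] are both
    [A_i + A_j]; permutations are products of transpositions. *)
Lemma skew_alternating k (a : kform R n k) :
  multilinear a -> alternating a -> skew a.
Proof.
move=> ma aa.
have swap (i j : 'I_k) A : i != j -> a (row_perm (tperm i j) A) = - a A.
  move=> ij.
  pose X (u v : 'rV[R]_n) : 'M[R]_(k, n) :=
    \matrix_l (if l == i then u else if l == j then v else row l A).
  have ji : (j == i) = false by rewrite eq_sym (negbTE ij).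
  have Xi u v : row i (X u v) = u by rewrite rowK eqxx.
  have Xj u v : row j (X u v) = v by rewrite rowK ji eqxx.
  have Xuu u : a (X u u) = 0 by apply: (aa _ i j); rewrite ?Xi ?Xj.
  have XDl u u' v : a (X (u + u') v) = a (X u v) + a (X u' v).
    rewrite -[a (X u v)]mul1r -[a (X u' v)]mul1r.
    apply: (ma i); rewrite ?Xi ?scale1r //;
      by apply/matrixP => l m; rewrite !mxE eq_sym (negbTE (neq_lift _ _)).
  have XDr u v v' : a (X u (v + v')) = a (X u v) + a (X u v').
    rewrite -[a (X u v)]mul1r -[a (X u v')]mul1r.
    apply: (ma j); rewrite ?Xj ?scale1r //; apply/matrixP => l m;
      by rewrite !mxE [lift _ _ == j]eq_sym (negbTE (neq_lift _ _)).
  have AE : A = X (row i A) (row j A).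
    apply/row_matrixP => l; rewrite rowK.
    by case: eqP => [->//|_]; case: eqP => [->|].
  have sE : row_perm (tperm i j) A = X (row j A) (row i A).
    apply/row_matrixP => l; rewrite rowK; apply/rowP => m; rewrite !mxE.
    case: tpermP => [->|->|/eqP/negbTE-> /eqP/negbTE->]; by rewrite ?eqxx ?ji mxE.
  have := Xuu (row i A + row j A).
  rewrite XDl !XDr !Xuu add0r addr0 -AE -sE => /eqP.
  by rewrite addrC addr_eq0 => /eqP.
move=> s A; case: (prod_tpermP s) => ts -> {s} /=.
elim: ts A => [|[i j] ts IH] A /=.
  by rewrite big_nil odd_perm1 row_perm1 mul1r.
move=> /andP[ij /IH {}IH]; rewrite big_cons row_permM swap // IH odd_mul_tperm ij.
by rewrite /= signrN mulNr.
Qed.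

(** Together with the sign rule, linearity in the first argument amounts to
    multilinearity; the Leibniz rules transmit it to products. *)
Definition first_linear k (a : kform R n k.+1) :=
  forall c u v, contract (c *: u + v) a = c *: contract u a + contract v a.

Lemma multilinear_first_linear k (a : kform R n k.+1) :
  multilinear a -> first_linear a.
Proof.
move=> ma c u v; apply/funext => A.
rewrite kformDE kformZE -[contract v a A]mul1r.
apply: (ma (ord0 : 'I_k.+1) (col_mx (c *: u + v) A) (col_mx u A) (col_mx v A)).
- by rewrite !row0_col_mx scale1r.
- by rewrite !row'0_col_mx.
- by rewrite !row'0_col_mx.
Qed.

Lemma first_linear0 k (a : kform R n k.+1) : first_linear a -> contract 0 a = 0.
Proof.
by move=> la; have := la (-1) 0 0; rewrite scaler0 addr0 scaleN1r addNr.
Qed.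

Lemma first_linear_sum k (a : kform R n k.+1) m (c : 'I_m -> R)
    (u : 'I_m -> 'rV[R]_n) A :
  first_linear a ->
  contract (\sum_i c i *: u i) a A = \sum_i c i * contract (u i) a A.
Proof.
move=> la; elim/big_rec2: _ => [|i x y _ IH]; first by rewrite first_linear0.
by rewrite la kformDE kformZE -IH.
Qed.

Lemma skew_row k (a : kform R n k.+1) i (A : 'M[R]_(k.+1, n)) :
  skew a -> contract (row i A) a (row' i A) = (-1) ^+ i * a A.
Proof.
move=> sa; have := sa (lift_perm ord0 i 1%g) A.
by rewrite row_perm_lift row_perm1 odd_lift_perm odd_perm1 addbF /= signr_odd.
Qed.

Lemma skew_eq_rows k (a : kform R n k) i j A :
  skew a -> i != j -> row i A = row j A -> a A = 0.
Proof.
move=> sa ij rij; have := sa (tperm i j) A.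
rewrite odd_tperm ij mulN1r (_ : row_perm _ A = A); first by lra.
apply/row_matrixP => l; apply/rowP => m; rewrite !mxE.
have rijE m' : A i m' = A j m'.
  by have := congr1 (fun v : 'rV_n => v 0 m') rij; rewrite !mxE.
by case: tpermP => [->|->|].
Qed.

(** The kernel of [a] has codimension at most [k], so any [k + 1] vectors admit
    a nontrivial combination [sum_j c_j A_j] in it. If [c_i <> 0], replacing row [i] by this combination multiplies the
    value by [c_i], as the other terms repeat a row, and makes it zero. *)
Lemma skew_eq0 k p (a : kform R n k.+1) (X : 'M[R]_(n, p)) :
  skew a -> first_linear a -> (forall v, v *m X = 0 -> contract v a = 0) ->
  (\rank X <= k)%N -> a = 0.
Proof.
move=> sa la Xa rX; apply/funext => A.
have : kermx (A *m X) != 0.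
  rewrite -mxrank_eq0 mxrank_ker -lt0n subn_gt0 ltnS.
  exact: leq_trans (mxrankM_maxr _ _) rX.
case/rowV0Pn => c /sub_kermxP; rewrite mulmxA => /Xa cA c0.
have [i ci] : exists i, c 0 i != 0.
  apply/existsP; apply: contraNT c0; rewrite negb_exists => /forallP c0.
  by apply/eqP/rowP => j; rewrite mxE; apply/eqP; move: (c0 j); rewrite negbK.
suff : contract (row i A) a (row' i A) = 0.
  rewrite skew_row // => /eqP; rewrite mulf_eq0 signr_eq0 /=.
  by move/eqP.
apply: (mulfI ci); rewrite mulr0.
transitivity (contract (c *m A) a (row' i A)); last by rewrite cA.
rewrite mulmx_sum_row first_linear_sum // (bigD1 i) //= big1 ?addr0 // => j ji.
case: (unliftP i j) ji => [l ->|->]; last by rewrite eqxx.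
move=> _; rewrite (_ : contract _ _ _ = 0) ?mulr0 //.
apply: (@skew_eq_rows _ _ (ord0 : 'I_k.+1) (lift (ord0 : 'I_k.+1) l)) => //.
by rewrite row0_col_mx rowS_col_mx row_row'.
Qed.

Definition form1_mx (t : kform R n 1) : 'M[R]_(n, 1) :=
  \col_i t (delta_mx 0 i).

Definition form2_mx (w : kform R n 2) : 'M[R]_n :=
  \matrix_(i, j) contract (delta_mx 0 i) w (delta_mx 0 j).

Lemma form1_mxE (t : kform R n 1) v :
  first_linear t -> t v = (v *m form1_mx t) 0 0.
Proof.
move=> lt; rewrite -contract1E {1}[v]row_sum_delta first_linear_sum //.
by rewrite mxE; apply: eq_bigr => i _; rewrite contract1E mxE.
Qed.

Lemma form2_mxE (w : kform R n 2) u v : skew w -> first_linear w ->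
  contract u w v = (u *m form2_mx w *m v^T) 0 0.
Proof.
move=> sw lw; rewrite {1}[u]row_sum_delta first_linear_sum // -mulmxA mxE.
apply: eq_bigr => i _; congr (_ * _).
rewrite skew2 // {1}[v]row_sum_delta first_linear_sum // mxE -sumrN.
by apply: eq_bigr => j _; rewrite !mxE skew2 // mulrN opprK mulrC.
Qed.

Lemma contract_form1_eq0 (t : kform R n 1) v :
  first_linear t -> contract v t = 0 <-> v *m form1_mx t = 0.
Proof.
move=> lt; split=> [tv|vt].
  apply/matrixP => i j; rewrite [i]ord1 [j]ord1 -form1_mxE // -contract1E tv.
  by rewrite mxE.
apply/funext => A; rewrite (_ : A = 0) ?contract1E ?form1_mxE ?vt ?mxE //.
by apply/matrixP; case.
Qed.

Lemma contract_form2_eq0 (w : kform R n 2) v : skew w -> first_linear w ->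
  contract v w = 0 <-> v *m form2_mx w = 0.
Proof.
move=> sw lw; split=> [wv|vw].
  apply/rowP => j; have : contract v w (delta_mx 0 j) = 0 by rewrite wv.
  by rewrite form2_mxE // trmx_delta -colE 2!mxE => ->; rewrite mxE.
by apply/funext => A; rewrite form2_mxE // vw mul0mx mxE.
Qed.

(** The kernel of [X] is parametrized injectively by the coordinates in a row
    basis of [kermx X]. *)
Lemma codim_kermx p (X : 'M[R]_(n, p)) :
  codim [set v : 'rV[R]_n | v *m X = 0] = \rank X.
Proof.
set K := [set _ | _]; pose f : 'Hom('rV[R]_(\rank (kermx X)), 'rV[R]_n) :=
  linfun (mulmxr (row_base (kermx X))).
have inK v : (v \in vspace_of K) <-> v *m X = 0.
  apply: mem_vspace_of; rewrite /K /= ?mul0mx // => c u u' uX u'X.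
  by rewrite mulmxDl -scalemxAl uX u'X scaler0 addr0.
have kE (C : 'rV[R]_n) : (C <= row_base (kermx X))%MS = (C <= kermx X)%MS.
  by rewrite eq_row_base.
have -> : codim K = (n - \dim (limg f))%N.
  rewrite /codim dimvf dim_matrix mul1r; congr (_ - \dim _)%N.
  apply/vspaceP => v; apply/idP/idP.
    move/inK/sub_kermxP; rewrite -kE => /submxP[c ->].
    apply/memv_imgP; exists c; rewrite ?memvf //.
    by rewrite lfunE.
  case/memv_imgP => c _ ->; apply/inK/sub_kermxP.
  by rewrite lfunE /= -kE submxMl.
rewrite limg_dim_eq; last first.
  apply/eqP; rewrite -subv0; apply/subvP => c; rewrite memv_cap memv_ker lfunE /=.
  case/andP => _ /eqP c0; rewrite memv0.
  apply/eqP/(row_free_inj (row_base_free (kermx X))).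
  by rewrite c0 mul0mx.
by rewrite dimvf dim_matrix mul1r mxrank_ker subKn // rank_leq_row.
Qed.

(** * Powers of a 2-form and the class of a pair *)

Section TwoForm.
Variable w : kform R n 2.
Hypotheses (sw : skew w) (lw : first_linear w).
Let W := form2_mx w.

Lemma first_linear_wedge_exp k :
  @first_linear (1 + k * 2) (wedge w (wedge_exp w k)).
Proof.
move=> c u v; rewrite !contract_wedge_exp // lw wedgeZDl.
by rewrite scalerDr !scalerA [_ * c]mulrC.
Qed.

Lemma wedge_exp_eq0 k : (\rank W < k.*2)%N -> wedge_exp w k = 0.
Proof.
case: k => // k; rewrite doubleS ltnS -muln2 => rW.
apply: (@skew_eq0 (1 + k * 2) n _ W) => //.
- exact: skew_wedge2.
- exact: first_linear_wedge_exp.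
move=> v /contract_form2_eq0 wv.
by rewrite contract_wedge_exp // wv // wedge0l scaler0.
Qed.

(** By induction on [k]: a vector [u] outside the kernel of [w] but orthogonal
    to [2k < rk] vectors on which [w^k] is nonzero makes
    [i_u w^(k+1)] nonzero. *)
Lemma wedge_exp_neq0 k : (k.*2 <= (\rank W).+1)%N -> wedge_exp w k <> 0.
Proof.
elim: k => [_|k IH]; first by move=> /(congr1 (@^~ 0)) /eqP; rewrite oner_eq0.
rewrite doubleS ltnS => rW w0; have {IH} := IH (leqW (ltnW rW)).
apply; apply/funext => A; apply: contrapT => wA.
(* The vectors orthogonal to the [2k] rows of [A] form a space of codimension
   at most [2k < rk], hence not all of them are in the kernel of [w]. *)
have /row_subPn[i] : ~~ (kermx (W *m A^T) <= kermx W)%MS.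
  apply: contraTN rW => /mxrankS; rewrite !mxrank_ker -leqNgt => rle.
  have := rank_leq_row W; have := rank_leq_col (W *m A^T).
  by move: rle; rewrite -muln2; lia.
set u := row i _ => uW.
have uA : u *m W *m A^T = 0.
  by rewrite -mulmxA; apply/sub_kermxP; rewrite row_sub.
have [v uv] : exists v, contract u w v <> 0.
  apply/existsNP => u0; move/negP: uW; apply.
  by apply/sub_kermxP/contract_form2_eq0 => //; apply/funext.
apply: wA; have := contract_wedge_exp k u sw.
have -> : wedge w (wedge_exp w k) = 0 by exact: w0.
move/(congr1 (fun a : kform R n _ => a (col_mx v A))).
rewrite kformZE wedge1E; last exact: skew_wedge_exp.
(* Only the term where [i_u w] takes [v] survives. *)
rewrite big_ord_recl big1; last first.
  move=> j _; rewrite rowS_col_mx form2_mxE // (_ : _ 0 0 = 0) ?mul0r ?mulr0 //.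
  by rewrite tr_row colE mulmxA uA mul0mx mxE.
rewrite addr0 mul1r row0_col_mx row'0_col_mx => /esym/eqP.
rewrite !mulf_eq0 pnatr_eq0 /= => /orP[/eqP//|/eqP//].
Qed.

(** For an odd rank [2s + 1], the power [w^(s+1)] would be nonzero by
    [wedge_exp_neq0], although its degree exceeds the rank. *)
Lemma rank_form2_even : ~~ odd (\rank W).
Proof.
apply/negP => oW; have rE := odd_double_half (\rank W); rewrite oW in rE.
apply: (@wedge_exp_neq0 (\rank W)./2.+1); first by lia.
by apply: wedge_exp_eq0; lia.
Qed.

Lemma wedge_exp_neq0P k : wedge_exp w k <> 0 <-> (k.*2 <= \rank W)%N.
Proof.
split=> [|kr]; last by apply: wedge_exp_neq0; lia.
by move=> w0; rewrite leqNgt; apply/negP => /wedge_exp_eq0.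
Qed.

(** Since [v] is in the kernel of [w], contracting [t /\ w^k] with [v] leaves
    [t(v) w^k]. *)
Lemma wedge1_exp_transverse (t : kform R n 1) v k :
  first_linear t -> contract v w = 0 -> t v != 0 ->
  wedge t (wedge_exp w k) = 0 -> wedge_exp w k = 0.
Proof.
move=> lt wv tv; case: k => [|k].
  move=> /(congr1 (fun a : kform R n 1 => contract v a)).
  rewrite contract_wedge1_deg0; last exact: (@skew_wedge_exp _ _ w 0).
  by move=> /eqP; rewrite scaler_eq0 (negbTE tv) => /eqP.
have wv0 : contract v (wedge w (wedge_exp w k)) = 0.
  by rewrite contract_wedge_exp // wv wedge0l scaler0.
move=> /(congr1 (fun a : kform R n (k.+1 * 2).+1 => contract v a)).
rewrite contract_wedge1; last exact: (@skew_wedge_exp _ _ w k.+1).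
rewrite [contract v _]wv0 wedge0r subr0.
by move=> /eqP; rewrite scaler_eq0 (negbTE tv) => /eqP.
Qed.

(** [t /\ w^(k+1) = w /\ (t /\ w^k)]. *)
Lemma wedge1_exp_monotone (t : kform R n 1) k m : (k <= m)%N ->
  wedge t (wedge_exp w k) = 0 -> wedge t (wedge_exp w m) = 0.
Proof.
move=> + t0; elim: m => [|m IH];
  first by rewrite leqn0 => /eqP k0; move: t0; rewrite k0.
rewrite leq_eqVlt => /predU1P[km|/IH tm]; first by move: t0; rewrite km.
rewrite [LHS]wedge12_comm //; last exact: skew_wedge_exp.
by rewrite tm wedge0r.
Qed.

(** Otherwise the kernel of the top power, of degree [2m + 2], would contain [v]
    besides the kernel of [w]. Their span has codimension [2m + 1], so the top
    power would vanish. That span is the kernel of [W *m cokermx (v *m W)]. *)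
Lemma contract_top v m : \rank W = m.+1.*2 -> contract v w <> 0 ->
  contract v (wedge w (wedge_exp w m)) <> 0.
Proof.
move=> rW wv wm; have : wedge_exp w m.+1 <> 0 by apply/wedge_exp_neq0P; rewrite rW.
apply; apply: (@skew_eq0 (1 + m * 2) n _ (W *m cokermx (v *m W))).
- exact: skew_wedge2.
- exact: first_linear_wedge_exp.
- move=> u; rewrite mulmxA => /eqP; rewrite -submxE => /submxP[c uv].
  have /contract_form2_eq0 wu : (u - c *m v) *m W = 0.
    by rewrite mulmxBl uv mulmxA subrr.
  (* [u W] is a multiple of [v W], so [u] is a multiple of [v] up to the
     kernel of [w]. *)
  have -> : u = c 0 0 *: v + (u - c *m v).
    by rewrite {2}[c]mx11_scalar mul_scalar_mx addrC subrK.
  rewrite [LHS]first_linear_wedge_exp [contract v _]wm.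
  by rewrite contract_wedge_exp // wu // wedge0l !scaler0 addr0.
have := mxrank_mul_ker W (cokermx (v *m W)).
have vW : v *m W != 0 by apply/eqP => /contract_form2_eq0 vW; apply: wv; apply: vW.
have : (v *m W <= W :&: kermx (cokermx (v *m W)))%MS.
  by rewrite sub_capmx submxMl; apply/sub_kermxP; rewrite mulmx_coker.
move/mxrankS; rewrite rank_rV vW rW -mul2n /=.
by move: (\rank (_ *m _)) (\rank (_ :&: _)) => x y; lia.
Qed.

(** [(k+1) t /\ w^k] is the contraction of [w^(k+1)] with [v]. This vanishes
    with [w^(k+1)]; conversely, if [t /\ w^k] vanishes then so do the products
    of [t] with higher powers, contrary to [contract_top]. *)
Lemma wedge1_exp_tangent (t : kform R n 1) v k :
  t = contract v w -> t <> 0 ->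
  wedge t (wedge_exp w k) <> 0 <-> (k.*2.+1 < \rank W)%N.
Proof.
move=> tE t0; have wv : contract v w <> 0 by rewrite -tE.
split=> [|kr tk].
  apply: contra_notT; rewrite -leqNgt => rk.
  have /(congr1 (fun a : kform R n (2 + k * 2) => @contract R n (1 + k * 2) v a)) :=
    @wedge_exp_eq0 k.+1 rk.
  rewrite [LHS]contract_wedge_exp // -tE => /eqP.
  by rewrite [_ == _](@scaler_eq0) pnatr_eq0 => /eqP.
have [m mr] : exists m, \rank W = m.+1.*2.
  exists (\rank W)./2.-1; have := rank_form2_even.
  have := odd_double_half (\rank W); lia.
apply: (contract_top mr wv); rewrite contract_wedge_exp // -tE.
have -> : wedge t (wedge_exp w m) = 0 by apply: (wedge1_exp_monotone _ tk); lia.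
by rewrite scaler0.
Qed.

(** The two cases are whether the linear form [t] lies in the image
    [{contract v w}] of [w], equivalently vanishes on the kernel of [w]. *)
Lemma class_dichotomy (t : kform R n 1) (lt : first_linear t) :
  let c := \rank (row_mx (form1_mx t) W) in
  (c = (\rank W).+1 /\
     forall k, wedge t (wedge_exp w k) <> 0 <-> (k.*2 <= \rank W)%N) \/
  (c = \rank W /\ (t <> 0 ->
     forall k, wedge t (wedge_exp w k) <> 0 <-> (k.*2.+1 < \rank W)%N)).
Proof.
move=> c; set T := form1_mx t.
have cE : c = \rank (T^T + W^T)%MS.
  by rewrite addsmxE -tr_row_mx mxrank_tr.
case: (boolP (T^T <= W^T)%MS) => [TW|TW]; [right|left].
  split; first by rewrite cE (addsmx_idPr TW) mxrank_tr.
  have /submxP[d dE] := TW.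
  have TE : T = W *m d^T by rewrite -[LHS]trmxK dE trmx_mul trmxK.
  (* The sign comes from [t u = w(u, d)], with [d] in second position. *)
  move=> t0 k; apply: (@wedge1_exp_tangent t (- d)) => //.
  apply/funext => u; rewrite form1_mxE // skew2 // form2_mxE //.
  rewrite linearN mulmxN [in RHS]mxE opprK -mulmxA.
  by rewrite -/W -TE.
(* Duality: a column annihilated by the left kernel of [W] is a combination of
   the columns of [W]. *)
have [v wv tv] : exists2 v, contract v w = 0 & t v != 0.
  have : kermx W *m T != 0.
    apply: contra TW => /eqP kT; rewrite submxE -[_ *m _]trmxK trmx_mul trmxK.
    have /submxP[D ->] : ((cokermx W^T)^T <= kermx W)%MS.
      by apply/sub_kermxP; rewrite -[W in _ *m W]trmxK -trmx_mul mulmx_coker trmx0.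
    by rewrite -mulmxA kT mulmx0 trmx0.
  case/matrix0Pn => i [j]; rewrite [j]ord1 => ij.
  exists (row i (kermx W)).
    by apply/contract_form2_eq0 => //; apply/sub_kermxP; rewrite row_sub.
  by rewrite form1_mxE // -row_mul mxE.
split=> [|k]; last first.
  rewrite -wedge_exp_neq0P; split=> wk e; apply: wk; first by rewrite e wedge0r.
  exact: wedge1_exp_transverse lt wv tv e.
have T1 : \rank T^T = 1%N.
  rewrite rank_rV; case: eqP => // T0.
  by rewrite T0 sub0mx in TW.
have /ltn_leqif TI := mxrank_leqif_sup (capmxSl T^T W^T).
rewrite sub_capmx (negbTE TW) andbF T1 in TI.
have := mxrank_sum_cap T^T W^T; rewrite T1 mxrank_tr -cE; move: TI => /=.
by case: (\rank (_ :&: _)) => // _; rewrite addn0 add1n.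
Qed.

End TwoForm.

End Rank.

(** * Forms on a manifold *)

Section Manifold.
Context {R : realType} {n : nat} {M : smooth_manifold R n}.

Lemma dform_skew k (a : diff_form M k) x : skew (a x).
Proof. exact/skew_alternating/dform_alternating/dform_multilinear. Qed.

Lemma dform_first_linear k (a : diff_form M k.+1) x : first_linear (a x).
Proof. exact/multilinear_first_linear/dform_multilinear. Qed.

Lemma form_rankE (omega : diff_form M 2) x :
  form_rank omega x = \rank (form2_mx (omega x)).
Proof.
have [sw lw] := (dform_skew omega x, dform_first_linear omega x).
rewrite -codim_kermx; congr codim.
by apply/seteqP; split=> v /(contract_form2_eq0 _ sw lw).
Qed.

Lemma form_classE (tau : diff_form M 1) (omega : diff_form M 2) x :
  form_class tau omega x =
    \rank (row_mx (form1_mx (tau x)) (form2_mx (omega x))).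
Proof.
rewrite -codim_kermx; congr codim.
have [lt lw] := (dform_first_linear tau x, dform_first_linear omega x).
have sw := dform_skew omega x.
apply/seteqP; split=> v /=.
  case=> /(contract_form1_eq0 _ lt) tv /(contract_form2_eq0 _ sw lw) wv.
  by rewrite mul_mx_row tv wv row_mx0.
rewrite mul_mx_row -[0]row_mx0 => /eq_row_mx[tv wv].
by split; [exact/contract_form1_eq0|exact/contract_form2_eq0].
Qed.

Lemma form_class_dichotomy (tau : diff_form M 1) (omega : diff_form M 2) x :
  let rk := form_rank omega x in let c := form_class tau omega x in
  ~~ odd rk /\
  ((c = rk.+1 /\ forall k,
      wedge (tau x) (wedge_exp (omega x) k) <> 0 <-> (k.*2 <= rk)%N) \/
   (c = rk /\ (tau x <> 0 -> forall k,
      wedge (tau x) (wedge_exp (omega x) k) <> 0 <-> (k.*2.+1 < rk)%N))).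
Proof.
rewrite /= form_rankE form_classE.
have [sw lw] := (dform_skew omega x, dform_first_linear omega x).
split; first exact: rank_form2_even.
exact: class_dichotomy (dform_first_linear tau x).
Qed.

Lemma dform_exp_neq0P (omega : diff_form M 2) x k :
  wedge_exp (omega x) k <> 0 <-> (k.*2 <= form_rank omega x)%N.
Proof.
rewrite form_rankE; apply: wedge_exp_neq0P; first exact: dform_skew.
exact: dform_first_linear.
Qed.

End Manifold.

Theorem corollary2p21 (R : realType) (n : nat) (M : smooth_manifold R n)
    (tau : diff_form M 1) (omega : diff_form M 2) (r : nat) :
  let cond_i :=
    (forall x : M, tau x <> fun=> 0) /\
    exists2 c : nat, (forall x : M, form_class tau omega x = c) &
      c = (2 * r + 1)%N \/ c = (2 * r + 2)%N in
  let cond_ii :=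
    (exists k : nat, forall x : M, form_rank omega x = k) /\
    forall x : M, wedge (tau x) (wedge_exp (omega x) r) <> (fun=> 0) /\
                  wedge (tau x) (wedge_exp (omega x) r.+1) = (fun=> 0) in
  (cond_i <-> cond_ii) /\
  (cond_i ->
    ((forall x : M, wedge_exp (omega x) r.+1 = fun=> 0) ->
       forall x : M, odd (form_class tau omega x)) /\
    (~ (forall x : M, wedge_exp (omega x) r.+1 = fun=> 0) ->
       forall x : M, ~~ odd (form_class tau omega x))).
Proof.
have pt x := form_class_dichotomy tau omega x.
have wx x k := dform_exp_neq0P omega x k.
(* The rank is even, so the parity of the class tells the two cases of [pt]
   apart. *)
have i_ii (x : M) c : tau x <> 0 -> form_class tau omega x = c ->
    c = (2 * r + 1)%N \/ c = (2 * r + 2)%N ->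
    [/\ form_rank omega x = (if odd c then c.-1 else c),
        wedge (tau x) (wedge_exp (omega x) r) <> 0 &
        wedge (tau x) (wedge_exp (omega x) r.+1) = 0].
  move=> t0 cx cr; have [ev H] := pt x.
  have H' : c = (form_rank omega x).+1 \/ c = form_rank omega x.
    by rewrite -cx; case: H => [[-> _]|[-> _]]; [left|right].
  have rkE : form_rank omega x = (if odd c then c.-1 else c).
    by case: H' => E; rewrite E /= ?ev ?(negbTE ev).
  split=> //.
    case: H => [[E ->]|[E ->//]]; rewrite cx in E; lia.
  apply: contrapT; case: H => [[E ->]|[E ->//]]; rewrite cx in E; lia.
have ii_i (x : M) : wedge (tau x) (wedge_exp (omega x) r) <> 0 ->
    wedge (tau x) (wedge_exp (omega x) r.+1) = 0 ->
    tau x <> 0 /\ form_class tau omega x =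
      if (form_rank omega x == r.*2)%N then (2 * r + 1)%N else (2 * r + 2)%N.
  move=> tr tr1; have t0 : tau x <> 0 by move=> t0; apply: tr; rewrite t0 wedge0l.
  split=> //; have [ev [[-> H]|[-> H]]] := pt x.
    move/H: tr => tr; have : ~~ (r.+1.*2 <= form_rank omega x)%N.
      by apply/negP => /H.
    case: eqP; lia.
  move/(H t0): tr => tr; have : ~~ (r.+1.*2.+1 < form_rank omega x)%N.
    by apply/negP => /(H t0).
  case: eqP; lia.
split; first split.
- case=> t0 [c cx cr]; split.
    by exists (if odd c then c.-1 else c) => x; have [] := i_ii x c (t0 x) (cx x) cr.
  by move=> x; have [] := i_ii x c (t0 x) (cx x) cr.
- case=> [[k rk] H]; split=> [x|]; first by have [/ii_i/[apply][[]]] := H x.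
  exists (if (k == r.*2)%N then (2 * r + 1)%N else (2 * r + 2)%N) => [x|].
    by have [/ii_i/[apply][[_ ->]]] := H x; rewrite rk.
  by case: eqP; [left|right].
case=> t0 [c cx cr]; have rkE x := let: And3 e _ _ := i_ii x c (t0 x) (cx x) cr in e.
split=> [w0 x|w0 x]; rewrite cx.
  have : ~~ (r.+1.*2 <= form_rank omega x)%N by apply/negP => /wx; apply; apply: w0.
  by rewrite rkE; case: ifP => //; lia.
have [y wy] : exists y : M, wedge_exp (omega y) r.+1 <> 0 by apply/existsNP.
by move/wx: wy; rewrite rkE; case: ifP => //; lia.
Qed.
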